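(* For every prime power $q$, the treewidth of the $q$-Kneser graph $\Gamma=K_q(4,2,1)$ equals $|V(\Gamma)|-(q^2+q+2)$.
   Context: $K_q(4,2,1)$ is the graph whose vertices are the $2$-dimensional subspaces of $F_q^4$, two vertices $U_1,U_2$ being adjacent iff $U_1\cap U_2=\{0\}$. Treewidth is the minimum, over tree decompositions $(T,(B_x)_{x\in V(T)})$ (a tree $T$ and vertex sets $B_x$ such that every edge lies in some $B_x$ and for each vertex $v$ the set $\{x:v\in B_x\}$ is nonempty and induces a connected subgraph of $T$), of $\max_x|B_x|-1$. *)

(* Defs.v *)
From HB Require Import structures.
From mathcomp Require Import all_boot all_order all_algebra.

Set Implicit Arguments.
Unset Strict Implicit.
Unset Printing Implicit Defensive.

Import GRing.Theory Num.Theory.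

(* {vspace vT} is a subtype of square matrices, hence finite over a finite
   field; the library stops at the choiceType structure. *)
Section VspaceFinite.
Import VectorInternalTheory.
Variables (F : finFieldType) (vT : vectType F).
HB.instance Definition _ := [Countable of {vspace vT} by <:].
HB.instance Definition _ := [Finite of {vspace vT} by <:].
End VspaceFinite.

Record sgraph := SGraph {
  svertex :> finType;
  sedge : rel svertex;
  sedge_sym : symmetric sedge;
  sedge_irr : irreflexive sedge }.

Definition induces_connected (G : sgraph) (A : {set G}) : Prop :=
  {in A &, forall x y,
    connect [rel a b | [&& a \in A, b \in A & sedge a b]] x y}.

(* A ucycle is a duplicate-free closed walk, so an edge traversed back and
   forth is a ucycle of size 2. *)
Definition acyclic (G : sgraph) : Prop :=
  forall c : seq G, ucycle (@sedge G) c -> size c < 3.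

Definition is_tree (T : sgraph) : Prop :=
  [/\ 0 < #|T|, forall x y : T, connect (@sedge T) x y & acyclic T].

Record tree_decomposition (G : sgraph) := TreeDecomposition {
  td_tree : sgraph;
  td_bag : td_tree -> {set G};
  td_treeP : is_tree td_tree;
  td_edgeP : forall u v : G, sedge u v ->
    exists x, (u \in td_bag x) && (v \in td_bag x);
  td_vertexP : forall v : G, [set x | v \in td_bag x] != set0;
  td_connectedP : forall v : G, induces_connected [set x | v \in td_bag x] }.

(* Integer-valued, so that the width is -1 when all bags are empty. *)
Definition td_width (G : sgraph) (D : tree_decomposition G) : int :=
  ((\max_(x : td_tree D) #|td_bag x|)%N%:Z - 1)%R.

Definition is_treewidth (G : sgraph) (w : int) : Prop :=
  (exists D : tree_decomposition G, td_width D = w) /\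
  (forall D : tree_decomposition G, (w <= td_width D)%R).

Lemma is_treewidth_uniq (G : sgraph) (w1 w2 : int) :
  is_treewidth G w1 -> is_treewidth G w2 -> w1 = w2.
Proof.
move=> [[D1 <-] min1] [[D2 <-] min2].
by apply/eqP; rewrite Order.POrderTheory.eq_le min1 min2.
Qed.

Section QKneser421.
Variable F : finFieldType.

Definition plane := {U : {vspace 'rV[F]_4} | \dim U == 2}.

Definition plane_disjoint : rel plane :=
  [rel U W | (val U :&: val W == 0)%VS].

Lemma plane_disjoint_sym : symmetric plane_disjoint.
Proof. by move=> U W; rewrite /plane_disjoint /= capvC. Qed.

Lemma plane_disjoint_irr : irreflexive plane_disjoint.
Proof.
move=> [U dimU]; rewrite /plane_disjoint /= capvv; apply/negP => /eqP U0.
by move: dimU; rewrite U0 dimv0.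
Qed.

Definition qkneser421 : sgraph := SGraph plane_disjoint_sym plane_disjoint_irr.

End QKneser421.

Definition prime_power (q : nat) : Prop :=
  exists p k : nat, [/\ prime p, 0 < k & q = p ^ k].

(* Main.v *)
Require Import Defs.
From mathcomp Require Import all_boot all_order all_algebra finfield.
From mathcomp Require Import zify.

Set Implicit Arguments.
Unset Strict Implicit.
Unset Printing Implicit Defensive.

Import GRing.Theory.

(* View the vertices as the lines of PG(3,q), adjacent when skew, and let [N] be
   their number.

   Upper bound: the [q^2+q+1] lines through a point form an independent set [I];
   a star with centre bag [~: I] and leaf bags [v |: N(v)], [v] in [I], is a tree
   decomposition whose bags have at most [N - (q^2+q+1)] elements.

   Lower bound: write [perp C] for the lines meeting every line of [C], and call
   [C] dominant if [perp C] is smaller than [perp (perp C)] in a fixed total order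
   on sets extending inclusion.  If no edge joined two dominant sets [B] and [C],
   then [C <= perp B] and [B <= perp C] would give the cycle
   [perp B < perp (perp B) <= perp C < perp (perp C) <= perp B].  So connected
   dominant sets form a bramble, and it remains to find one inside every set [A]
   of more than [q^2+q+1] lines.  Such an [A] contains skew lines, and, by counting
   in the grid of transversals of two skew lines, a path [m1 - m2 - m3].  Let [C]
   be the component of this path and [M = {m1, m2, m3}].  At most [2q] lines of
   [perp M] are outside [perp (perp M)].  Hence if [C] is not dominant, it has at
   most [2q] elements, and [A :\: C], a subset of [perp M] with at least [q+2]
   elements, contains a path of three lines whose perp lies in [perp (perp M)].
   The component [D] of that path satisfies [perp D = perp (perp C)] and
   [perp (perp D) = perp C], so [D] is dominant. *)

(** * Tree decompositions *)

Lemma acyclic_bridge (T : sgraph) (x y : T) : acyclic T -> sedge x y ->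
  ~~ connect [rel a b | sedge a b &&
      ~~ ((a == x) && (b == y) || (a == y) && (b == x))] x y.
Proof.
move=> acT exy; apply/negP => /connectP [p0 path0 last0].
case: (shortenP path0) last0 => p pathp uniqp _ lastp.
have := acT (x :: p).
rewrite /ucycle uniqp andbT /= rcons_path -lastp sedge_sym exy andbT.
rewrite (sub_path _ pathp) => [|a b /andP[] //].
case: p pathp lastp {uniqp} => [|a [|b p]] //=.
- by move=> _ e; move: exy; rewrite e sedge_irr.
- by rewrite andbT => /andP[_ n] e; rewrite e !eqxx in n.
by move=> _ _ /(_ isT).
Qed.

Lemma finite_tree_reversal (T : sgraph) (f : T -> T) : acyclic T -> 0 < #|T| ->
  (forall x, sedge x (f x)) -> exists x, f (f x) = x.
Proof.
move=> acT /card_gt0P [x0 _] ef.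
have /trajectP [i lti itE] := looping_order f x0.
set x := iter i f x0.
have per : exists n, iter n.+1 f x = x.
  exists (order f x0 - i).-1; rewrite prednK ?subn_gt0 //.
  by rewrite /x -iterD subnK // ltnW.
have fc : fcycle f (orbit f x) by apply/(@orbitPcycle _ f x 0 3).
have xo : iter (order f x) f x = x by apply/(@orbitPcycle _ f x 4 0).
exists x.
have uc : ucycle (@sedge T) (orbit f x).
  rewrite /ucycle orbit_uniq andbT.
  by apply: sub_cycle fc => a b /= /eqP <-.
have := acT _ uc; rewrite size_orbit.
move: xo; have := order_gt0 f x; case: (order f x) => [|[|[|m]]] //= _ e _.
by have := ef x; rewrite e sedge_irr.
Qed.

(* Send each node [x] to its neighbour in the direction of [beta x].  In a finite
   tree some edge is then traversed both ways; it separates the two sets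
   [beta x] and [beta y] at its ends. *)
Lemma no_haven (G : sgraph) (D : tree_decomposition G)
    (beta : td_tree D -> {set G}) :
    (forall x, beta x != set0) -> (forall x, induces_connected (beta x)) ->
    (forall x, [disjoint beta x & td_bag x]) ->
  ~ (forall x y, exists a b, [/\ a \in beta x, b \in beta y & sedge a b]).
Proof.
move=> b0 bC bD touch.
have [T0 Tc acT] := td_treeP D.
pose away (x : td_tree D) := [rel a b : td_tree D | [&& a != x, b != x & sedge a b]].
have away_sym x : connect_sym (away x).
  by apply: sym_connect_sym => a b /=; rewrite sedge_sym andbCA.
have /fin_all_exists [f fP] : forall x, exists y, sedge x y /\
   forall v z, v \in beta x -> v \in td_bag z -> connect (away x) y z.
  move=> x; have /set0Pn [v0 v0b] := b0 x.
  have same v z z' : v \in beta x -> v \in td_bag z -> v \in td_bag z' ->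
      connect (away x) z z'.
    move=> vb vz vz'.
    have := @td_connectedP _ D v z z'; rewrite !inE => /(_ vz vz').
    apply: connect_sub => a b /=; rewrite !inE => /and3P [va vb' eab].
    apply: connect1 => /=; rewrite eab andbT.
    by apply/andP; split; apply/eqP => e; move: (disjointFr (bD x) vb);
       rewrite -e ?va ?vb'.
  have /set0Pn [z0] := td_vertexP D v0; rewrite inE => v0z0.
  have xz0 : x != z0.
    by apply/eqP => e; move: (disjointFr (bD x) v0b); rewrite e v0z0.
  have /connectP [p0 path0 last0] := Tc x z0.
  case: (shortenP path0) last0 => [[|y p] /=] pathp uniqp _ lastp.
    by rewrite lastp eqxx in xz0.
  exists y; move: pathp uniqp => /andP [exy pathp] /andP [xp _]; split=> //.
  have yz0 : connect (away x) y z0.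
    apply/connectP; exists p => //.
    elim: p y {exy} pathp xp {lastp} => //= c p IH y /andP [eyc pathp].
    rewrite !inE !negb_or => /and3P [xy xc xp].
    by rewrite eyc eq_sym xy eq_sym xc /= IH // inE negb_or xc.
  move=> v z vb vz.
  have /connectP [s paths lasts] := bC x v0 v v0b vb.
  have {}lasts : v = last v0 s by [].
  elim: s v0 z0 v0b v0z0 {xz0 lastp} yz0 paths lasts => [|w s IH] v0 z0 v0b v0z0 yz0.
    by move=> _ /= e; apply: connect_trans yz0 (same v _ _ _ _ vz); rewrite e.
  rewrite /= => /andP [/and3P [_ wb e0w]] paths lasts.
  have [z1 /andP [v0z1 wz1]] := td_edgeP D e0w.
  by apply: IH wb wz1 _ paths lasts; apply: connect_trans yz0 (same v0 _ _ _ _ _).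
have [x fx] := finite_tree_reversal acT T0 (fun x => (fP x).1).
have [exy xP] := fP x; have [_ yP] := fP (f x); rewrite {}fx in yP.
set y := f x in exy xP yP.
have [a [b [aX bY eab]]] := touch x y.
have [z /andP [az bz]] := td_edgeP D eab.
have /negP := acyclic_bridge acT exy; apply.
apply: (@connect_trans _ _ z).
  apply: connect_sub (yP b z bY bz) => c d /= /and3P [cy dy ecd].
  by apply: connect1; rewrite /= ecd (negPf cy) (negPf dy) andbF.
move: (xP a z aX az); rewrite away_sym.
apply: connect_sub => c d /= /and3P [cy dy ecd].
by apply: connect1; rewrite /= ecd (negPf cy) (negPf dy) andbF.
Qed.

Section SetKey.
Variable T : finType.
Implicit Types S U : {set T}.

(* Lexicographic in (cardinality, rank): a total order extending inclusion. *)
Definition set_key S : nat := #|S| * #|{set T}| + enum_rank S.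

Lemma set_key_card S U : set_key S <= set_key U -> #|S| <= #|U|.
Proof.
have := ltn_ord (enum_rank U); rewrite /set_key leqNgt => rU; apply: contraTleq.
by move=> cU; rewrite -ltnNge; apply: leq_trans (leq_addr _ _);
  apply: leq_trans (leq_mul cU (leqnn _)); rewrite mulSn addnC ltn_add2r.
Qed.

Lemma set_key_inj : injective set_key.
Proof.
move=> S U e; apply: enum_rank_inj; apply: val_inj => /=.
have cSU : #|S| = #|U|.
  by apply/eqP; rewrite eqn_leq !set_key_card // e.
by move: e; rewrite /set_key cSU => /addnI.
Qed.

Lemma set_keyS S U : S \subset U -> set_key S <= set_key U.
Proof.
rewrite subEproper => /orP [/eqP -> // | /proper_card cSU].
by rewrite leqNgt; apply/negP => /ltnW /set_key_card; rewrite leqNgt cSU.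
Qed.

End SetKey.

Section Perp.
Variable G : sgraph.
Implicit Types (A B C : {set G}) (u v : G).

Definition perp C : {set G} := [set v | [forall c in C, ~~ sedge c v]].

Lemma perpP C v : reflect (forall c, c \in C -> ~~ sedge c v) (v \in perp C).
Proof. by rewrite inE; apply: forall_inP. Qed.

Lemma perpS B C : B \subset C -> perp C \subset perp B.
Proof.
by move=> BC; apply/subsetP => v /perpP vC; apply/perpP => c /(subsetP BC) /vC.
Qed.

Lemma sub_perpC B C : (B \subset perp C) = (C \subset perp B).
Proof.
by apply/subsetP/subsetP => h v hv; apply/perpP => c hc; rewrite sedge_sym;
   move/perpP: (h _ hc); apply.
Qed.

Lemma sub_perp2 C : C \subset perp (perp C).
Proof. by rewrite -sub_perpC. Qed.

Lemma perp3 C : perp (perp (perp C)) = perp C.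
Proof. by apply/eqP; rewrite eqEsubset sub_perp2 perpS ?sub_perp2. Qed.

Definition dominant C := set_key (perp C) < set_key (perp (perp C)).

Lemma dominant_touch B C : dominant B -> dominant C ->
  exists b c, [/\ b \in B, c \in C & sedge b c].
Proof.
move=> dB dC.
case: (boolP [exists b in B, exists c in C, sedge b c]) => [|no].
  by case/exists_inP=> b bB /exists_inP [c cC e]; exists b, c.
have CB : C \subset perp B.
  apply/subsetP => c cC; apply/perpP => b bB; apply: contra no => e.
  by apply/exists_inP; exists b => //; apply/exists_inP; exists c.
have h1 := set_keyS (perpS CB).
have BC : B \subset perp C by rewrite sub_perpC.
have h2 := set_keyS (perpS BC).
by move: dB dC; rewrite /dominant => dB dC; lia.
Qed.

Lemma max_bag_lower_bound (m : nat) :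
  (forall A, m < #|A| ->
     exists C, [/\ C \subset A, C != set0, induces_connected C & dominant C]) ->
  forall D : tree_decomposition G, #|G| - m <= \max_(x : td_tree D) #|td_bag x|.
Proof.
move=> domP D; rewrite leqNgt; apply/negP => small.
have /fin_all_exists [beta betaP] (x : td_tree D) : exists C,
    [/\ C \subset ~: td_bag x, C != set0, induces_connected C & dominant C].
  apply: domP; rewrite cardsCs setCK ltn_subRL addnC -ltn_subRL.
  by apply: leq_ltn_trans small; apply: (leq_bigmax (F := fun y => #|td_bag y|)).
apply: (@no_haven _ D beta) => [x|x|x|x y].
- by case: (betaP x).
- by case: (betaP x).
- by rewrite disjoints_subset; case: (betaP x).
by apply: dominant_touch; [case: (betaP x) | case: (betaP y)].
Qed.

Definition component A v : {set G} :=
  [set u | connect [rel a b | [&& a \in A, b \in A & sedge a b]] v u].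

Lemma component_id A v : v \in component A v.
Proof. by rewrite inE connect0. Qed.

Lemma restrict_connect_sym A :
  connect_sym [rel a b : G | [&& a \in A, b \in A & sedge a b]].
Proof. by apply: sym_connect_sym => a b /=; rewrite sedge_sym andbCA. Qed.

Lemma component_sub A v : v \in A -> component A v \subset A.
Proof.
move=> vA; apply/subsetP => u; rewrite inE restrict_connect_sym.
by case/connectP => [[|w p]] /= => [_ <- // | /andP [/andP [] ]].
Qed.

Lemma component_edge A v a b : v \in A -> a \in component A v -> b \in A ->
  sedge a b -> b \in component A v.
Proof.
move=> vA aC bA e; have aA := subsetP (component_sub vA) _ aC.
move: aC; rewrite !inE => va; apply: connect_trans va _.
by apply: connect1; rewrite /= aA bA.
Qed.

Lemma component_connected A v : v \in A -> induces_connected (component A v).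
Proof.
move=> vA x y xC yC.
have : connect [rel a b | [&& a \in A, b \in A & sedge a b]] x y.
  move: xC yC; rewrite !inE => vx vy.
  by apply: connect_trans vy; rewrite restrict_connect_sym.
case/connectP => p pathp ->; apply/connectP; exists p => //.
elim: p x xC pathp => //= z p IH x xC /andP [/and3P [xA zA exz] pathp].
have zC := component_edge vA xC zA exz.
by rewrite xC zC exz IH.
Qed.

Lemma component_perp A v : v \in A -> A :\: component A v \subset perp (component A v).
Proof.
move=> vA; apply/subsetP => u /setDP [uA uC]; apply/perpP => c cC.
by apply: contra uC; apply: component_edge.
Qed.

Lemma component_neighbour A v u : u \in A -> v \in A -> sedge v u ->
  forall c, c \in component A v -> exists2 d, d \in component A v & sedge c d.
Proof.
move=> uA vA evu c cC.
move: (cC); rewrite inE restrict_connect_sym.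
case/connectP => [[|d p]] /= => [_ <-|/andP [/and3P [_ dA ecd] _] _].
  by exists u => //; apply: component_edge evu; rewrite ?component_id.
by exists d => //; apply: component_edge ecd.
Qed.

Lemma component_disjoint A v u : v \in A -> u \in A -> u \notin component A v ->
  component A u \subset A :\: component A v.
Proof.
move=> vA uA uC; rewrite subsetD component_sub //=.
rewrite disjoints_subset; apply/subsetP => w; rewrite !inE => uw.
apply: contra uC => vw; rewrite inE; apply: connect_trans vw _.
by rewrite restrict_connect_sym.
Qed.

End Perp.

Section Star.
Variable T : finType.

Definition star_edge : rel (option T) := [rel x y | isSome x != isSome y].

Lemma star_edge_sym : symmetric star_edge.
Proof. by move=> x y; rewrite /star_edge /= eq_sym. Qed.

Lemma star_edge_irr : irreflexive star_edge.
Proof. by move=> x; rewrite /star_edge /= eqxx. Qed.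

Definition star : sgraph := SGraph star_edge_sym star_edge_irr.

Lemma star_is_tree : is_tree star.
Proof.
split=> [|x y|].
- by apply/card_gt0P; exists None.
- apply: (@connect_trans _ _ None); case: x y => [x|] [y|] //;
    by apply: connect1.
case=> [|[x|] [|[y|] [|[z|] [|[w|] s]]]] //.
all: by rewrite /ucycle ?/star_edge /= ?inE ?andbF.
Qed.

End Star.

Lemma star_decomposition (G : sgraph) (I : {set G}) (n : nat) :
    {in I &, forall u v, ~~ sedge u v} -> #|~: I| <= n ->
    (forall v, v \in I -> #|v |: [set u | sedge v u]| <= n) ->
  exists D : tree_decomposition G, \max_(x : td_tree D) #|td_bag x| <= n.
Proof.
move=> indepI nI nN.
pose bag (x : star G) : {set G} :=
  if x is Some v then if v \in I then v |: [set u | sedge v u] else set0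
  else ~: I.
have bagN v : (v \in bag None) = (v \notin I) by rewrite inE.
have bagS u v : (v \in bag (Some u)) = (u \in I) && ((v == u) || sedge u v).
  by rewrite /=; case: ifP => _; rewrite !inE.
have edgeP (u v : G) : sedge u v -> exists x, (u \in bag x) && (v \in bag x).
  move=> e; case: (boolP (u \in I)) => uI.
    by exists (Some u); rewrite !bagS uI eqxx e orbT.
  case: (boolP (v \in I)) => vI.
    by exists (Some v); rewrite !bagS vI eqxx sedge_sym e orbT.
  by exists None; rewrite !bagN uI vI.
have vertexP (v : G) : [set x | v \in bag x] != set0.
  apply/set0Pn; case: (boolP (v \in I)) => vI.
    by exists (Some v); rewrite inE bagS vI eqxx.
  by exists None; rewrite inE bagN vI.
have connP (v : G) : induces_connected [set x | v \in bag x].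
  case: (boolP (v \in I)) => vI.
    have only x : x \in [set x | v \in bag x] -> x = Some v.
      case: x => [u|]; rewrite inE ?bagN ?vI // bagS => /andP [uI].
      by case/orP => [/eqP -> // | e]; have := indepI _ _ uI vI; rewrite e.
    by move=> x y /only -> /only ->.
  move=> x y xv yv.
  have step z : z \in [set x | v \in bag x] -> z = None \/
    [&& z \in [set x | v \in bag x], None \in [set x | v \in bag x] &
       @sedge (star G) z None].
    case: z => [z|] zv; last by left.
    by right; rewrite zv inE bagN vI.
  have cN z : z \in [set x | v \in bag x] ->
      connect [rel a b | [&& a \in [set x | v \in bag x],
                b \in [set x | v \in bag x] & sedge a b]] z None.
    by case/step => [-> // | e]; apply: connect1.
  apply: connect_trans (cN x xv) _.
  by rewrite restrict_connect_sym; apply: cN.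
exists (TreeDecomposition (star_is_tree G) edgeP vertexP connP).
apply/bigmax_leqP => -[v|] _ //=.
by case: ifP => [/nN // | _]; rewrite cards0.
Qed.

Lemma dominant_near_path (G : sgraph) (q : nat) (A : {set G}) (m1 m2 m3 : G)
    (M := [set m1; m2; m3]) :
    M \subset A -> sedge m2 m1 -> sedge m2 m3 -> 3 * q + 1 < #|A| ->
    #|perp M :\: perp (perp M)| <= 2 * q ->
    (forall B : {set G}, B \subset perp M -> q + 1 < #|B| -> exists r r' s,
       [/\ [set r; r'; s] \subset B, sedge s r, sedge s r' &
           perp [set r; r'; s] \subset perp (perp M)]) ->
  exists C : {set G}, [/\ C \subset A, C != set0, induces_connected C & dominant C].
Proof.
move=> MA e21 e23 cA cM crossP.
have [m1A m2A m3A] : [/\ m1 \in A, m2 \in A & m3 \in A].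
  by move/subsetP: MA => MA; split; apply: MA; rewrite !inE eqxx ?orbT.
pose C := component A m2.
have m2C : m2 \in C by apply: component_id.
have MC : M \subset C.
  apply/subsetP => m; rewrite !inE -orbA => /or3P [] /eqP ->.
  - by have := component_edge m2A m2C m1A e21; rewrite inE.
  - by rewrite connect0.
  - by have := component_edge m2A m2C m3A e23; rewrite inE.
have good v : v \in A -> dominant (component A v) ->
    exists C : {set G}, [/\ C \subset A, C != set0, induces_connected C & dominant C].
  move=> vA dv; exists (component A v); split=> //; first exact: component_sub.
    by apply/set0Pn; exists v; apply: component_id.
  exact: component_connected.
case: (boolP (dominant C)) => [|ndC]; first exact: good.
have disC c : c \in C -> c \notin perp C.
  move=> cC; have [d dC ecd] := component_neighbour m1A m2A e21 cC.
  by apply/negP => /perpP /(_ d dC); rewrite sedge_sym ecd.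
have kC : set_key (perp (perp C)) <= set_key (perp C) by rewrite leqNgt.
have pCM : perp C \subset perp M by apply: perpS.
have ppMC : perp (perp M) \subset perp (perp C) by do 2!apply: perpS.
have cC : #|C| <= 2 * q.
  have c1 : #|perp C :\: perp (perp C)| <= 2 * q.
    by apply: leq_trans cM; apply: subset_leq_card; apply: setDSS.
  have c2 := set_key_card kC.
  have c3 : C \subset perp (perp C) :\: perp C.
    by apply/subsetP => c cC; rewrite inE disC // (subsetP (sub_perp2 C)).
  have := subset_leq_card c3.
  have := cardsID (perp (perp C)) (perp C); have := cardsID (perp C) (perp (perp C)).
  rewrite (setIC (perp (perp C))).
  lia.
have ACp : A :\: C \subset perp C by apply: component_perp.
have [||r [r' [s [rB esr esr' sP]]]] := crossP (A :\: C).
- exact: subset_trans ACp pCM.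
- by rewrite cardsDS ?component_sub //; lia.
have inB v : v \in [set r; r'; s] -> v \in A /\ v \notin C.
  by move/(subsetP rB)/setDP.
have [] : [/\ r \in A, r' \in A & s \in A].
  by split; apply: (inB _ _).1; rewrite !inE eqxx ?orbT.
move=> rA r'A sA; have sC : s \notin C by apply: (inB _ _).2; rewrite !inE eqxx orbT.
pose D := component A s.
have sD : s \in D by apply: component_id.
have DC : D \subset perp C.
  by apply: subset_trans ACp; apply: component_disjoint.
have TD : [set r; r'; s] \subset D.
  apply/subsetP => m; rewrite !inE -orbA => /or3P [] /eqP ->.
  - by have := component_edge sA sD rA esr; rewrite inE.
  - by have := component_edge sA sD r'A esr'; rewrite inE.
  - by rewrite connect0.
have eD : perp D = perp (perp C).
  apply/eqP; rewrite eqEsubset (perpS DC) andbT.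
  by apply: subset_trans (perpS TD) (subset_trans sP ppMC).
apply: (good s) => //; rewrite /dominant -/D eD perp3 ltn_neqAle kC andbT.
apply/eqP => /set_key_inj e.
by have := disC _ m2C; rewrite -e (subsetP (sub_perp2 C)).
Qed.

(** * Incidence of subspaces *)

Section Incidence.
Variables (F : fieldType) (vT : vectType F).
Implicit Types (U W p t m x : {vspace vT}).
Local Open Scope vspace_scope.

Lemma dimv_gt0 U : (0 < \dim U)%N = (U != 0).
Proof. by rewrite lt0n dimv_eq0. Qed.

Lemma meetS U W x : x != 0 -> x <= U -> x <= W -> U :&: W != 0.
Proof.
rewrite -!dimv_gt0 => d xU xW; apply: leq_trans d _.
by apply: dimvS; rewrite subv_cap xU.
Qed.

Lemma dim_gt_meet (U W V : {vspace vT}) :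
  U <= V -> W <= V -> (\dim V < \dim U + \dim W)%N -> U :&: W != 0.
Proof.
move=> UV WV d; rewrite -dimv_gt0; have := dimv_sum_cap U W.
by have : (\dim (U + W) <= \dim V)%N; [apply: dimvS; rewrite subv_add UV | lia].
Qed.

Lemma distinct_points p p' : \dim p = 1%N -> \dim p' = 1%N -> p != p' ->
  p :&: p' = 0 /\ \dim (p + p') = 2%N.
Proof.
move=> dp dp' pp'; have c0 : p :&: p' = 0.
  apply/eqP; apply: contraNT pp'; rewrite -dimv_gt0 => d.
  have e1 : p :&: p' = p by apply/eqP; rewrite eqEdim capvSl dp.
  have e2 : p :&: p' = p' by apply/eqP; rewrite eqEdim capvSr dp'.
  by rewrite -e1 e2.
by split=> //; rewrite dimv_disjoint_sum ?c0 // dp dp'.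
Qed.

Lemma span_points p p' m : \dim m = 2%N -> \dim p = 1%N -> \dim p' = 1%N ->
  p <= m -> p' <= m -> p != p' -> p + p' = m.
Proof.
move=> dm dp dp' pm p'm pp'; have [_ d] := distinct_points dp dp' pp'.
by apply/eqP; rewrite eqEdim subv_add pm p'm d dm.
Qed.

Lemma distinct_lines t m : \dim t = 2%N -> \dim m = 2%N -> t != m ->
  t :&: m != 0 -> \dim (t :&: m) = 1%N /\ \dim (t + m) = 3.
Proof.
move=> dt dm tm; rewrite -dimv_gt0 => d.
have := dimv_sum_cap t m.
have : (\dim (t :&: m) < 2)%N.
  rewrite ltnNge; apply: contra tm => d2.
  have e1 : t :&: m = t by apply/eqP; rewrite eqEdim capvSl dt.
  have e2 : t :&: m = m by apply/eqP; rewrite eqEdim capvSr dm.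
  by rewrite -e1 e2.
lia.
Qed.

Lemma point_in_cap p t m : \dim p = 1%N -> \dim (t :&: m) = 1%N ->
  p <= t -> p <= m -> t :&: m = p.
Proof.
by move=> dp d pt pm; apply/esym/eqP; rewrite eqEdim subv_cap pt pm dp d.
Qed.

Section Transversal.
Variables (m1 m2 : {vspace vT}).
Hypothesis m12 : m1 :&: m2 = 0.

Lemma transversal_points t : \dim t = 2%N -> t :&: m1 != 0 -> t :&: m2 != 0 ->
  [/\ \dim (t :&: m1) = 1%N, \dim (t :&: m2) = 1%N & t :&: m1 + t :&: m2 = t].
Proof.
rewrite -!dimv_gt0 => dt d1 d2.
have c0 : (t :&: m1) :&: (t :&: m2) = 0.
  by apply/eqP; rewrite -subv0 -m12; apply: capvS; apply: capvSr.
have d : \dim (t :&: m1 + t :&: m2) = (\dim (t :&: m1) + \dim (t :&: m2))%N.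
  exact: dimv_disjoint_sum.
have s : t :&: m1 + t :&: m2 <= t by rewrite subv_add !capvSl.
have := dimvS s; rewrite d dt => d3.
by split; [lia | lia | apply/eqP; rewrite eqEdim s d dt; lia].
Qed.

Lemma transversal_eq t t' : \dim t = 2%N -> \dim t' = 2%N ->
  t :&: m1 != 0 -> t :&: m2 != 0 -> t' :&: m1 != 0 -> t' :&: m2 != 0 ->
  t :&: m1 = t' :&: m1 -> t :&: m2 = t' :&: m2 -> t = t'.
Proof.
move=> dt dt' t1 t2 t1' t2' e1 e2.
have [_ _ <-] := transversal_points dt t1 t2.
have [_ _ <-] := transversal_points dt' t1' t2'.
by rewrite e1 e2.
Qed.

Lemma sub_add_of_points t t' m : \dim m = 2%N ->
  \dim (t :&: m) = 1%N -> \dim (t' :&: m) = 1%N -> t :&: m != t' :&: m ->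
  m <= t + t'.
Proof.
move=> dm d d' n; rewrite -(span_points dm d d' _ _ n) ?capvSr //.
by apply: addvS; apply: capvSl.
Qed.

Lemma meeting_transversals t t' : \dim m1 = 2%N -> \dim m2 = 2%N ->
  \dim t = 2%N -> \dim t' = 2%N ->
  t :&: m1 != 0 -> t :&: m2 != 0 -> t' :&: m1 != 0 -> t' :&: m2 != 0 ->
  t :&: t' != 0 -> t :&: m1 = t' :&: m1 \/ t :&: m2 = t' :&: m2.
Proof.
move=> dm1 dm2 dt dt' t1 t2 t1' t2' tt'.
case: (eqVneq (t :&: m1) (t' :&: m1)) => [->|n1]; first by left.
case: (eqVneq (t :&: m2) (t' :&: m2)) => [->|n2]; first by right.
have [d1 d2 _] := transversal_points dt t1 t2.
have [d1' d2' _] := transversal_points dt' t1' t2'.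
have s : m1 + m2 <= t + t' by rewrite subv_add !sub_add_of_points.
have := dimvS s; rewrite dimv_disjoint_sum // dm1 dm2.
by move: tt'; rewrite -dimv_gt0; have := dimv_sum_cap t t'; lia.
Qed.

End Transversal.

Lemma meets_two_sub t m1 m2 : \dim t = 2%N -> t :&: m1 != 0 -> t :&: m2 != 0 ->
  t :&: (m1 :&: m2) = 0 -> t <= m1 + m2.
Proof.
rewrite -!dimv_gt0 => dt t1 t2 t12.
have c0 : (t :&: m1) :&: (t :&: m2) = 0.
  apply/eqP; rewrite -subv0 -t12 !subv_cap.
  rewrite (subv_trans (capvSl _ _) (capvSl _ _)).
  rewrite (subv_trans (capvSl _ _) (capvSr _ _)).
  by rewrite (subv_trans (capvSr _ _) (capvSr _ _)).
have s : t :&: m1 + t :&: m2 <= t by rewrite subv_add !capvSl.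
have d : \dim (t :&: m1 + t :&: m2) = (\dim (t :&: m1) + \dim (t :&: m2))%N.
  exact: dimv_disjoint_sum.
have <- : t :&: m1 + t :&: m2 = t by apply/eqP; rewrite eqEdim s d dt; lia.
by apply: addvS; apply: capvSr.
Qed.

Lemma point_notin p U : \dim p = 1%N -> ~~ (p <= U) -> U :&: p = 0.
Proof.
move=> dp; apply: contraNeq; rewrite -dimv_gt0 => d.
have <- : U :&: p = p by apply/eqP; rewrite eqEdim capvSr dp.
exact: capvSl.
Qed.

Lemma meet_pencil p r r' t x : \dim p = 1%N -> \dim r = 2%N -> \dim r' = 2%N ->
  \dim t = 2%N -> \dim x = 2%N -> r != r' -> p <= r -> p <= r' -> p <= t ->
  t <= r + r' -> x :&: r != 0 -> x :&: r' != 0 -> x :&: t != 0.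
Proof.
move=> dp dr dr' dt dx rr' pr pr' pt trr' xr xr'.
have p0 : p != 0 by rewrite -dimv_gt0 dp.
have [dc ds] := distinct_lines dr dr' rr' (meetS p0 pr pr').
have rE : r :&: r' = p by apply: point_in_cap.
case: (boolP (p <= x)) => [px|px]; first exact: meetS p0 px pt.
apply: (@dim_gt_meet _ _ (r + r')) => //; last by rewrite ds dx dt.
by apply: meets_two_sub => //; rewrite rE; apply: point_notin.
Qed.

End Incidence.

Section Counting.
Variable F : finFieldType.
Let q := #|F|.
Implicit Types (U W p t m x : {vspace 'rV[F]_4}).
Local Open Scope vspace_scope.

Definition points U : {set {vspace 'rV[F]_4}} := [set p | (\dim p == 1%N) && (p <= U)].

Lemma card_nonzero U : #|[set v in U | v != 0%R]| = (q ^ \dim U - 1)%N.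
Proof.
rewrite -(card_vspace (T := 'rV[F]_4)) (cardD1 0%R [in U]) mem0v add1n subn1 /=.
by apply: eq_card => v; rewrite !inE andbC.
Qed.

Lemma card_points_mul U : (#|points U| * (q - 1) = q ^ \dim U - 1)%N.
Proof.
rewrite -card_nonzero -[RHS]sum1_card.
rewrite (partition_big (fun v => <[v]>) [in points U]) /=; last first.
  by move=> v; rewrite !inE => /andP [vU v0]; rewrite dim_vline v0 -memvE.
rewrite -sum_nat_const; apply: eq_bigr => p; rewrite inE => /andP [/eqP dp pU].
have := card_nonzero p; rewrite dp expn1 => <-; rewrite -sum1_card.
apply: eq_bigl => v; rewrite !inE; apply/andP/andP => [[vp v0]|[/andP [vU v0] /eqP <-]].
  split; first by rewrite (subvP pU).
  by rewrite eqEdim -memvE vp dp dim_vline v0.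
by rewrite memv_line.
Qed.

Lemma card_points2 U : \dim U = 2%N -> #|points U| = q.+1.
Proof.
have q1 : (1 < q)%N := finNzRing_gt1 F.
by move=> dU; have := card_points_mul U; rewrite dU; nia.
Qed.

Lemma card_points3 U : \dim U = 3%N -> #|points U| = (q ^ 2 + q + 1)%N.
Proof.
have q1 : (1 < q)%N := finNzRing_gt1 F.
by move=> dU; have := card_points_mul U; rewrite dU; nia.
Qed.

Definition pencil U p : {set plane F} := [set t | (p <= val t) && (val t <= U)].

Lemma card_pencil U p : \dim p = 1%N -> p <= U -> #|pencil U p| = #|points (U :\: p)|.
Proof.
move=> dp pU; set W := (U :\: p).
have pW : p :&: W = 0 by rewrite capvC; apply: capv_diff.
have WU : W <= U by apply: diffvSl.
have UE : W + p = U by rewrite addv_diff; apply/addv_idPl.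
have cross t : \dim t = 2%N -> p <= t -> t <= U ->
    \dim (t :&: W) = 1%N /\ p + (t :&: W) = t.
  move=> dt pt tU.
  have s : t <= p + (t :&: W).
    apply/subvP => v vt.
    have : v \in W + p by rewrite UE (subvP tU).
    case/memv_addP => w wW [u up vE].
    rewrite vE addrC memv_add // memv_cap wW andbT.
    have -> : w = (v - u)%R by rewrite vE addrK.
    by rewrite rpredB // (subvP pt).
  have e : p + (t :&: W) = t.
    by apply/eqP; rewrite eqEsubv s subv_add pt capvSl.
  split=> //; have := congr1 (fun X => \dim X) e.
  rewrite dimv_disjoint_sum ?dp ?dt; first by case.
  by apply/eqP; rewrite -subv0 -pW; apply: capvS => //; apply: capvSr.
rewrite -(@card_in_imset _ _ (fun t : plane F => val t :&: W) (mem (pencil U p))).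
  apply: eq_card => w; apply/imsetP/idP => [[t]|].
    rewrite inE => /andP [pt tU] ->.
    by rewrite inE capvSr andbT; case: (cross _ (eqP (valP t)) pt tU) => ->.
  rewrite inE => /andP [/eqP dw wW].
  have c0 : p :&: w = 0 by apply/eqP; rewrite -subv0 -pW; apply: capvS.
  have d : \dim (p + w) == 2%N by rewrite dimv_disjoint_sum // dp dw.
  have lU : p + w <= U by rewrite subv_add pU (subv_trans wW).
  exists (exist _ (p + w) d); first by rewrite inE /= addvSl.
  have [d1 _] := cross _ (eqP d) (addvSl _ _) lU.
  by apply/eqP; rewrite eqEdim /= subv_cap addvSr wW d1 dw.
move=> t t'; rewrite !inE => /andP [pt tU] /andP [pt' tU'] e; apply: val_inj => /=.
have [_ <-] := cross _ (eqP (valP t)) pt tU.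
by have [_ <-] := cross _ (eqP (valP t')) pt' tU'; rewrite /= e.
Qed.

Lemma dim_rV4 : \dim {: 'rV[F]_4} = 4.
Proof. by rewrite dimvf dim_matrix. Qed.

Lemma card_pencil_fullv p : \dim p = 1%N -> #|pencil fullv p| = (q ^ 2 + q + 1)%N.
Proof.
move=> dp; rewrite card_pencil ?subvf // card_points3 //.
have := dimv_cap_compl fullv p; rewrite capfv dp dim_rV4; lia.
Qed.

Lemma card_pencil3 U p : \dim U = 3 -> \dim p = 1%N -> p <= U -> #|pencil U p| = q.+1.
Proof.
move=> dU dp pU; rewrite card_pencil // card_points2 //.
have := dimv_cap_compl U p; have /capv_idPr -> := pU; rewrite dp dU; lia.
Qed.

Lemma card_lines_in U (I : {set plane F}) : \dim U = 3 ->
  (forall t : plane F, t \in I -> val t <= U) -> (#|I| <= q ^ 2 + q + 1)%N.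
Proof.
move=> dU IU; rewrite -(leq_pmul2r (ltn0Sn q)) -(card_points3 dU).
rewrite -!sum_nat_const.
rewrite (eq_bigr (fun t : plane F => \sum_(p in points U | (p <= val t)%VS) 1)%N).
  rewrite (exchange_big_dep [in points U]) /=; last by move=> t p _ /andP [].
  apply: leq_sum => p; rewrite inE => /andP [/eqP dp pU].
  rewrite sum1dep_card -(card_pencil3 dU dp pU).
  apply: subset_leq_card; apply/subsetP => t; rewrite !inE.
  by move=> /andP [/IU -> /andP [_ ->]].
move=> t tI; rewrite sum1dep_card -(card_points2 (eqP (valP t))).
apply: eq_card => p; rewrite !inE -andbA; congr (_ && _).
by case: (boolP (p <= val t)) => [pt|]; rewrite ?andbF ?andbT // (subv_trans pt) ?IU.
Qed.

End Counting.

(** * Lines meeting a path of the graph *)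

Section Lines.
Variable F : finFieldType.
Let q := #|F|.
Let G := qkneser421 F.
Implicit Types (t m l : G) (I S : {set G}).
Local Open Scope vspace_scope.

Lemma dim_line t : \dim (val t) = 2%N.
Proof. exact: eqP (valP t). Qed.

Lemma line_neq t l : t != l -> val t != val l.
Proof. by apply: contra => /eqP/val_inj ->. Qed.

Lemma nonadjacent t l : ~~ sedge t l -> val t :&: val l != 0.
Proof. by []. Qed.

Lemma intersecting_card I :
  {in I &, forall t l, ~~ sedge t l} -> (#|I| <= q ^ 2 + q + 1)%N.
Proof.
move=> indI; case: (leqP #|I| 1) => [c1|]; first by lia.
case/card_gt1P => l1 [l2 [l1I l2I l12]].
have [dP dU] := distinct_lines (dim_line l1) (dim_line l2) (line_neq l12)
  (indI _ _ l1I l2I).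
set P := val l1 :&: val l2 in dP; set U := val l1 + val l2 in dU.
have PorU t : t \in I -> ~~ (P <= val t) -> val t <= U.
  move=> tI Pt; apply: meets_two_sub (dim_line t) (indI _ _ tI l1I) (indI _ _ tI l2I) _.
  exact: point_notin.
case: (boolP [forall t in I, P <= val t]) => [/forall_inP allP|].
  rewrite -(card_pencil_fullv dP); apply: subset_leq_card; apply/subsetP => t tI.
  by rewrite inE allP // subvf.
rewrite negb_forall => /existsP [l3]; rewrite negb_imply => /andP [l3I Pl3].
have l3U := PorU _ l3I Pl3.
apply: (@card_lines_in _ U _ dU) => t tI.
apply/negP => /negP tU.
have Pt : P <= val t by apply: contraNT tU; apply: PorU.
have PU : P <= U by apply: subv_trans (capvSl _ _) (addvSl _ _).
have dtU : \dim (val t :&: U) = 1%N.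
  have := dimvS (capvSl (val t) U); have : (0 < \dim (val t :&: U))%N.
    by rewrite dimv_gt0; apply: (meetS _ Pt PU); rewrite -dimv_gt0 dP.
  have : \dim (val t :&: U) != 2%N.
    apply: contra tU => /eqP d2.
    have <- : val t :&: U = val t by apply/eqP; rewrite eqEdim capvSl d2 dim_line.
    exact: capvSr.
  by rewrite dim_line; case: (\dim _) => [|[|[|n]]].
have tUP : val t :&: U = P by apply: point_in_cap.
have : val t :&: val l3 != 0 := indI _ _ tI l3I.
case/negP; rewrite -subv0 -(point_notin dP Pl3) subv_cap capvSr -tUP.
by apply: capvS.
Qed.

Lemma transversal_fiber_card (m1 m2 a x : {vspace 'rV[F]_4}) S :
  m1 :&: m2 = 0 -> \dim m2 = 2%N -> \dim x = 1%N -> x <= m2 ->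
  (forall t, t \in S -> [/\ val t :&: m1 != 0, val t :&: m2 != 0,
      val t :&: m1 = a & val t :&: m2 != x]) -> (#|S| <= q)%N.
Proof.
move=> m12 d2 dx xm SP.
rewrite -(@card_in_imset _ _ (fun t : G => val t :&: m2) (mem S)); last first.
  move=> t t' /SP [t1 t2 e _] /SP [t1' t2' e' _] /= e2; apply: val_inj.
  by apply: (transversal_eq m12) => //; rewrite ?dim_line // e.
have xP : x \in points m2 by rewrite inE dx xm.
have : (#|points m2 :\ x| <= q)%N.
  by rewrite -ltnS -[q.+1](card_points2 d2) (cardsD1 x (points m2)) xP.
apply: leq_trans; apply: subset_leq_card; apply/subsetP => p.
case/imsetP => t /SP [t1 t2 e nx] ->.
rewrite !inE nx capvSr andbT /=.
by have [_ -> _] := transversal_points m12 (dim_line t) t1 t2.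
Qed.

Section Path.
Variables m1 m2 m3 : G.
Hypotheses (e21 : sedge m2 m1) (e23 : sedge m2 m3) (m13 : m1 != m3).
Let M : {set G} := [set m1; m2; m3].

Let skew12 : val m1 :&: val m2 = 0.
Proof. by rewrite capvC; apply/eqP. Qed.
Let skew32 : val m3 :&: val m2 = 0.
Proof. by rewrite capvC; apply/eqP. Qed.

Lemma perp_pathE t : (t \in perp M) =
  [&& val t :&: val m1 != 0, val t :&: val m2 != 0 & val t :&: val m3 != 0].
Proof.
apply/perpP/and3P => [h|[h1 h2 h3] m].
  by split; rewrite capvC; apply: h; rewrite !inE eqxx ?orbT.
by rewrite !inE -orbA => /or3P [] /eqP -> ; rewrite sedge_sym.
Qed.

Lemma regulus_card : sedge m1 m3 -> (#|perp M| <= q + 1)%N.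
Proof.
move=> e13; have skew13 : val m1 :&: val m3 = 0 by apply/eqP.
rewrite addn1 -(card_points2 (dim_line m2)).
rewrite -(@card_in_imset _ _ (fun t : G => val t :&: val m2) (mem (perp M))).
  apply: subset_leq_card; apply/subsetP => p /imsetP [t].
  rewrite perp_pathE => /and3P [t1 t2 t3] ->; rewrite inE capvSr andbT.
  by have [_ -> _] := transversal_points skew12 (dim_line t) t1 t2.
move=> t t'; rewrite !perp_pathE => /and3P [t1 t2 t3] /and3P [t1' t2' t3'] /= e2.
apply/eqP; apply: contraT => /line_neq tt'.
have c0 : val t :&: val t' != 0.
  apply: (meetS t2); first exact: capvSl.
  by rewrite e2 capvSl.
have [_ ds] := distinct_lines (dim_line t) (dim_line t') tt' c0.
have sub (m : G) : val m :&: val m2 = 0 -> val t :&: val m != 0 ->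
    val t' :&: val m != 0 -> val m <= val t + val t'.
  move=> sm tm tm'.
  have [d _ _] := transversal_points sm (dim_line t) tm t2.
  have [d' _ _] := transversal_points sm (dim_line t') tm' t2'.
  apply: sub_add_of_points => //; first exact: dim_line.
  apply: contra tt' => /eqP e; apply/eqP.
  by apply: (transversal_eq sm) => //; apply: dim_line.
have : val m1 :&: val m3 != 0.
  apply: (dim_gt_meet (sub _ skew12 t1 t1') (sub _ skew32 t3 t3')).
  by rewrite ds !dim_line.
by rewrite skew13 eqxx.
Qed.

Section Cross.
Hypothesis ne13 : ~~ sedge m1 m3.
Let P := val m1 :&: val m3.
Let U := val m1 + val m3.
Let Q := val m2 :&: U.

Let dP : \dim P = 1%N.
Proof. by case: (distinct_lines (dim_line m1) (dim_line m3) (line_neq m13) ne13). Qed.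
Let dU : \dim U = 3.
Proof. by case: (distinct_lines (dim_line m1) (dim_line m3) (line_neq m13) ne13). Qed.
Let P1 : P <= val m1. Proof. exact: capvSl. Qed.
Let P3 : P <= val m3. Proof. exact: capvSr. Qed.
Let PU : P <= U. Proof. exact: subv_trans P1 (addvSl _ _). Qed.
Let Q2 : Q <= val m2. Proof. exact: capvSl. Qed.
Let QU : Q <= U. Proof. exact: capvSr. Qed.

Let dQ : \dim Q = 1%N.
Proof.
have := dimv_sum_cap (val m2) U; rewrite dim_line dU -/Q.
have := dimvS (subvf (val m2 + U)); rewrite dim_rV4.
have := dimvS Q2; rewrite dim_line.
have : \dim Q != 2%N.
  apply/eqP => d2.
  have m2U : val m2 <= U.
    have <- : Q = val m2 by apply/eqP; rewrite eqEdim Q2 d2 dim_line.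
    exact: capvSr.
  have : val m1 :&: val m2 != 0.
    by apply: (dim_gt_meet (addvSl _ _) m2U); rewrite dU !dim_line.
  by rewrite skew12 eqxx.
by move: (\dim Q) (\dim (_ + _)); clear; lia.
Qed.

Let P0 : P != 0. Proof. by rewrite -dimv_gt0 dP. Qed.
Let Q0 : Q != 0. Proof. by rewrite -dimv_gt0 dQ. Qed.

Let PQ : P :&: Q = 0.
Proof. by apply/eqP; rewrite -subv0 -skew12; apply: capvS. Qed.

Let dz : \dim (P + Q) == 2%N.
Proof. by rewrite dimv_disjoint_sum // dP dQ. Qed.

Let z : G := exist _ (P + Q) dz.
Let Pz : P <= val z. Proof. exact: addvSl. Qed.
Let Qz : Q <= val z. Proof. exact: addvSr. Qed.

Let onP t := (t \in perp M) && (P <= val t).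
Let onQ t := (t \in perp M) && (val t <= U).

Let perp_cases t : t \in perp M -> onP t \/ onQ t.
Proof.
move=> tM; rewrite /onP /onQ tM; move: tM; rewrite perp_pathE => /and3P [t1 t2 t3].
case: (boolP (P <= val t)) => Pt; [by left | right].
exact: meets_two_sub (dim_line t) t1 t3 (point_notin dP Pt).
Qed.

Let onP_cap t : onP t -> val t :&: val m1 = P.
Proof.
case/andP; rewrite perp_pathE => /and3P [t1 t2 t3] Pt.
have [d _ _] := transversal_points skew12 (dim_line t) t1 t2.
exact: point_in_cap.
Qed.

Let onQ_cap t : onQ t -> val t :&: val m2 = Q.
Proof.
case/andP; rewrite perp_pathE => /and3P [t1 t2 t3] tU.
have [_ d _] := transversal_points skew12 (dim_line t) t1 t2.
by apply/eqP; rewrite eqEdim d dQ /Q subv_cap capvSr (subv_trans (capvSl _ _) tU).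
Qed.

Let onQ_sub t : onQ t -> Q <= val t.
Proof. by move/onQ_cap <-; apply: capvSl. Qed.

Let zM : z \in perp M.
Proof. by rewrite perp_pathE (meetS P0 Pz P1) (meetS Q0 Qz Q2) (meetS P0 Pz P3). Qed.

Let onPz : onP z. Proof. by rewrite /onP zM Pz. Qed.
Let onQz : onQ z. Proof. by rewrite /onQ zM subv_add PU QU. Qed.

Let zMM : z \in perp (perp M).
Proof.
apply/perpP => t /perp_cases [/andP [_ Pt]|/onQ_sub Qt].
  exact: meetS P0 Pt Pz.
exact: meetS Q0 Qt Qz.
Qed.

Let eq_z t : t \in perp M -> val t :&: val m1 = P -> val t :&: val m2 = Q -> t = z.
Proof.
move=> tM e1 e2; apply: val_inj; move: (tM) (zM); rewrite !perp_pathE.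
move=> /and3P [t1 t2 _] /and3P [z1 z2 _].
apply: (transversal_eq skew12); rewrite ?dim_line ?(onP_cap onPz) ?(onQ_cap onQz) //.
Qed.

Let Rs (B : {set G}) := [set t in B | onP t] :\ z.
Let Ss (B : {set G}) := [set t in B | onQ t] :\ z.

Let in_Rs B t : (t \in Rs B) = [&& t != z, t \in B & onP t].
Proof. by rewrite in_setD1 in_set. Qed.
Let in_Ss B t : (t \in Ss B) = [&& t != z, t \in B & onQ t].
Proof. by rewrite in_setD1 in_set. Qed.

Let card_Rs B : (#|Rs B| <= q)%N.
Proof.
apply: (transversal_fiber_card (a := P) skew12 (dim_line m2) dQ Q2) => t.
rewrite in_Rs => /and3P [tz _ tP]; have /andP [tM _] := tP.
move: (tM); rewrite perp_pathE => /and3P [t1 t2 _]; split=> //; first exact: onP_cap.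
by apply: contra tz => /eqP e; rewrite (eq_z tM (onP_cap tP) e).
Qed.

Let card_Ss B : (#|Ss B| <= q)%N.
Proof.
have skew21 : val m2 :&: val m1 = 0 by rewrite capvC.
apply: (transversal_fiber_card (a := Q) skew21 (dim_line m1) dP P1) => t.
rewrite in_Ss => /and3P [tz _ tQ]; have /andP [tM _] := tQ.
move: (tM); rewrite perp_pathE => /and3P [t1 t2 _]; split=> //; first exact: onQ_cap.
by apply: contra tz => /eqP e; rewrite (eq_z tM e (onQ_cap tQ)).
Qed.

Lemma cross_card : (#|(perp M :\: perp (perp M))%SET| <= 2 * q)%N.
Proof.
apply: (@leq_trans #|Rs (perp M) :|: Ss (perp M)|).
  apply: subset_leq_card; apply/subsetP => t /setDP [tM tMM].
  have tz : t != z by apply: contra tMM => /eqP ->.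
  by rewrite in_setU in_Rs in_Ss tz tM; apply/orP; apply: perp_cases.
by apply: leq_trans (leq_card_setU _ _) _; rewrite mul2n -addnn leq_add.
Qed.

Let RS_skew B r s : r \in Rs B -> s \in Ss B -> sedge s r.
Proof.
rewrite in_Rs in_Ss => /and3P [rz _ rP] /and3P [sz _ sQ].
have /andP [rM _] := rP; have /andP [sM _] := sQ.
apply: contraT => /nonadjacent sr.
move: (rM) (sM); rewrite !perp_pathE => /and3P [r1 r2 _] /and3P [s1 s2 _].
have [e|e] := meeting_transversals skew12 (dim_line m1) (dim_line m2)
  (dim_line s) (dim_line r) s1 s2 r1 r2 sr.
  by move: sz; rewrite (eq_z sM _ (onQ_cap sQ)) ?eqxx // e (onP_cap rP).
by move: rz; rewrite (eq_z rM (onP_cap rP)) ?eqxx // -e (onQ_cap sQ).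
Qed.

Let onP_plane r r' t : onP r -> onP r' -> onP t -> r != r' -> val t <= val r + val r'.
Proof.
move=> rP r'P tP /line_neq rr'.
have sub u : onP u -> val u <= P + val m2.
  move=> uP; have /andP [uM _] := uP; move: uM; rewrite perp_pathE => /and3P [u1 u2 _].
  have [_ _ <-] := transversal_points skew12 (dim_line u) u1 u2.
  by rewrite (onP_cap uP); apply: addvS => //; apply: capvSr.
have [_ ds] := distinct_lines (dim_line r) (dim_line r') rr'
   (meetS P0 (andP rP).2 (andP r'P).2).
suff -> : val r + val r' = P + val m2 by apply: sub.
apply/eqP; rewrite eqEdim ds subv_add !sub //= dimv_disjoint_sum ?dP ?dim_line //.
by apply/eqP; rewrite -subv0 -skew12; apply: capvS.
Qed.

Let onQ_plane r r' t : onQ r -> onQ r' -> onQ t -> r != r' -> val t <= val r + val r'.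
Proof.
move=> rQ r'Q tQ /line_neq rr'.
have [_ ds] := distinct_lines (dim_line r) (dim_line r') rr'
   (meetS Q0 (onQ_sub rQ) (onQ_sub r'Q)).
suff -> : val r + val r' = U by case/andP: tQ.
by apply/eqP; rewrite eqEdim ds dU subv_add (andP rQ).2 (andP r'Q).2.
Qed.

Let meet_onP r r' t (x : G) : onP r -> onP r' -> onP t -> r != r' ->
  val x :&: val r != 0 -> val x :&: val r' != 0 -> val x :&: val t != 0.
Proof.
move=> rP r'P tP rr'.
exact: meet_pencil dP (dim_line r) (dim_line r') (dim_line t) (dim_line x)
  (line_neq rr') (andP rP).2 (andP r'P).2 (andP tP).2 (onP_plane rP r'P tP rr').
Qed.

Let meet_onQ r r' t (x : G) : onQ r -> onQ r' -> onQ t -> r != r' ->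
  val x :&: val r != 0 -> val x :&: val r' != 0 -> val x :&: val t != 0.
Proof.
move=> rQ r'Q tQ rr'.
exact: meet_pencil dQ (dim_line r) (dim_line r') (dim_line t) (dim_line x)
  (line_neq rr') (onQ_sub rQ) (onQ_sub r'Q) (onQ_sub tQ) (onQ_plane rQ r'Q tQ rr').
Qed.

Lemma cross_closed (B : {set G}) : B \subset perp M -> (q + 1 < #|B|)%N -> exists r r' s,
  [/\ [set r; r'; s] \subset B, sedge s r, sedge s r' &
      perp [set r; r'; s] \subset perp (perp M)].
Proof.
move=> BM cB; have q1 := finNzRing_gt1 F.
have BE : B \subset z |: (Rs B :|: Ss B).
  apply/subsetP => t tB; rewrite in_setU1 in_setU in_Rs in_Ss tB.
  case: (eqVneq t z) => //= _; apply/orP; apply: perp_cases.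
  exact: (subsetP BM).
have cRS : (q < #|Rs B| + #|Ss B|)%N.
  have h : (#|B| <= 1 + (#|Rs B| + #|Ss B|))%N.
    apply: leq_trans (subset_leq_card BE) _.
    by rewrite cardsU1 leq_add ?leq_b1 ?leq_card_setU.
  by have := leq_trans cB h; rewrite addn1 add1n ltnS.
have arith (a b n : nat) : (1 < n -> n < a + b -> b <= n -> 0 < a /\ (a <= 1 -> 1 < b))%N.
  by clear; lia.
have [cR cS] := (card_Rs B, card_Ss B).
have RB r : r \in Rs B -> [/\ r != z, r \in B & onP r].
  by rewrite in_Rs => /and3P [].
have SB r : r \in Ss B -> [/\ r != z, r \in B & onQ r].
  by rewrite in_Ss => /and3P [].
have meets (r r' s t : G) : t \in perp [set r; r'; s] ->
    [/\ val t :&: val r != 0, val t :&: val r' != 0 & val t :&: val s != 0].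
  by move/perpP => h; split; rewrite capvC; apply: h; rewrite !inE eqxx ?orbT.
have subB (r r' s : G) : r \in B -> r' \in B -> s \in B -> [set r; r'; s] \subset B.
  by move=> *; rewrite !subUset !sub1set; apply/andP; split=> //; apply/andP.
case: (leqP #|Rs B| 1) => cR1.
  have /card_gt1P [r [r' [rS r'S rr']]] : (1 < #|Ss B|)%N.
    by case: (arith _ _ _ q1 cRS cS) => _; apply.
  have /card_gt0P [s sR] : (0 < #|Rs B|)%N by case: (arith _ _ _ q1 cRS cS).
  have [_ rB rQ] := SB _ rS; have [_ r'B r'Q] := SB _ r'S; have [sz sB sP] := RB _ sR.
  exists r, r', s; split;
    rewrite ?subB ?(sedge_sym s) ?(RS_skew sR rS) ?(RS_skew sR r'S) //.
  apply/subsetP => t /meets [tr tr' ts]; apply/perpP => u uM.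
  rewrite sedge_sym; have tz := meet_onQ rQ r'Q onQz rr' tr tr'.
  case: (perp_cases uM) => uu; first exact: meet_onP sP onPz uu sz ts tz.
  exact: meet_onQ rQ r'Q uu rr' tr tr'.
have /card_gt1P [r [r' [rR r'R rr']]] := cR1.
have /card_gt0P [s sS] : (0 < #|Ss B|)%N.
  by rewrite addnC in cRS; case: (arith _ _ _ q1 cRS cR).
have [_ rB rP] := RB _ rR; have [_ r'B r'P] := RB _ r'R; have [sz sB sQ] := SB _ sS.
exists r, r', s; split; rewrite ?subB ?(RS_skew rR sS) ?(RS_skew r'R sS) //.
apply/subsetP => t /meets [tr tr' ts]; apply/perpP => u uM.
rewrite sedge_sym; have tz := meet_onP rP r'P onPz rr' tr tr'.
case: (perp_cases uM) => uu; last exact: meet_onQ sQ onQz uu sz ts tz.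
exact: meet_onP rP r'P uu rr' tr tr'.
Qed.

End Cross.
End Path.
End Lines.

(** * Dominant sets of lines and the treewidth *)

Section Treewidth.
Variable F : finFieldType.
Let q := #|F|.
Let G := qkneser421 F.
Implicit Types (t m l : G) (A B I S : {set G}).
Local Open Scope vspace_scope.

Section Grid.
Variables m1 m2 : G.
Hypothesis e12 : sedge m1 m2.
Let skew : val m1 :&: val m2 = 0. Proof. exact/eqP. Qed.

Definition is_transversal_to t := (val t :&: val m1 != 0) && (val t :&: val m2 != 0).

Lemma grid_matching_card l1 l2 B : sedge l1 l2 ->
    is_transversal_to l1 -> is_transversal_to l2 ->
    {in B, forall t, [/\ is_transversal_to t, ~~ sedge t l1 & ~~ sedge t l2]} ->
  (#|B| <= 2)%N.
Proof.
move=> el /andP [l11 l12] /andP [l21 l22] BP.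
have sl : val l1 :&: val l2 = 0 by apply/eqP.
have n1 : val l1 :&: val m1 != val l2 :&: val m1.
  apply: contraTneq l11 => e; rewrite negbK -subv0 -sl subv_cap capvSl.
  by rewrite e capvSl.
have n2 : val l1 :&: val m2 != val l2 :&: val m2.
  apply: contraTneq l12 => e; rewrite negbK -subv0 -sl subv_cap capvSl.
  by rewrite e capvSl.
have coord t : t \in B ->
  (val t :&: val m1 = val l1 :&: val m1 /\ val t :&: val m2 = val l2 :&: val m2) \/
  (val t :&: val m1 = val l2 :&: val m1 /\ val t :&: val m2 = val l1 :&: val m2).
  case/BP => /andP [t1 t2] tl1 tl2.
  have [a|a] := meeting_transversals skew (dim_line m1) (dim_line m2)
    (dim_line t) (dim_line l1) t1 t2 l11 l12 tl1;
  have [b|b] := meeting_transversals skew (dim_line m1) (dim_line m2)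
    (dim_line t) (dim_line l2) t1 t2 l21 l22 tl2.
  - by rewrite -a -b eqxx in n1.
  - by left.
  - by right.
  - by rewrite -a -b eqxx in n2.
rewrite -card_bool.
rewrite -(@card_in_imset _ _
  (fun t : G => val t :&: val m1 == val l1 :&: val m1) (mem B)).
  exact: max_card.
move=> t t' tB t'B /= e; apply: val_inj.
have [/andP [t1 t2] _ _] := BP _ tB; have [/andP [t1' t2'] _ _] := BP _ t'B.
have [a b] : val t :&: val m1 = val t' :&: val m1 /\ val t :&: val m2 = val t' :&: val m2.
  case: (coord _ tB) (coord _ t'B) e => -[-> ->] [] [-> ->] //;
    by rewrite eqxx eq_sym (negPf n1).
exact: (transversal_eq skew (dim_line t) (dim_line t')).
Qed.

Lemma grid_intersecting_card B : {in B, forall t, is_transversal_to t} ->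
  {in B &, forall t l, ~~ sedge t l} -> (#|B| <= 2 * q + 1)%N.
Proof.
move=> BT BI; case: (set_0Vmem B) => [->|[l lB]]; first by rewrite cards0.
have /andP [l1 l2] := BT _ lB.
have [d1 d2 _] := transversal_points skew (dim_line l) l1 l2.
pose S1 := [set t in B :\ l | val t :&: val m1 == val l :&: val m1].
pose S2 := [set t in B :\ l | val t :&: val m2 == val l :&: val m2].
have BE : B :\ l \subset S1 :|: S2.
  apply/subsetP => t tBl; have /setD1P [_ tB] := tBl.
  have /andP [t1 t2] := BT _ tB; apply/setUP.
  by have [e|e] := meeting_transversals skew (dim_line m1) (dim_line m2)
    (dim_line t) (dim_line l) t1 t2 l1 l2 (BI _ _ tB lB); [left|right];
    rewrite in_set tBl e eqxx.
have inj t : t \in B -> t != l -> val t :&: val m1 = val l :&: val m1 ->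
    val t :&: val m2 != val l :&: val m2.
  move=> tB tl e1; have /andP [t1 t2] := BT _ tB; apply: contra tl => /eqP e2.
  apply/eqP; apply: val_inj.
  exact: (transversal_eq skew (dim_line t) (dim_line l)).
have c1 : (#|S1| <= q)%N.
  apply: (transversal_fiber_card skew (dim_line m2) d2 (capvSr _ _)) => t.
  rewrite in_set => /andP [/setD1P [tl tB] /eqP e].
  have /andP [t1 t2] := BT _ tB.
  by split=> //; [exact: e | exact: inj].
have skew' : val m2 :&: val m1 = 0 by rewrite capvC.
have c2 : (#|S2| <= q)%N.
  apply: (transversal_fiber_card skew' (dim_line m1) d1 (capvSr _ _)) => t.
  rewrite in_set => /andP [/setD1P [tl tB] /eqP e].
  have /andP [t1 t2] := BT _ tB.
  split=> //; first exact: e.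
  by apply/negP => /eqP e1; have := inj _ tB tl e1; rewrite e eqxx.
rewrite (cardsD1 l) lB addnC leq_add2r mul2n -addnn.
apply: leq_trans (subset_leq_card BE) _.
by apply: leq_trans (leq_card_setU _ _) _; apply: leq_add.
Qed.

End Grid.

Lemma matching_card A :
    {in A & &, forall m2 m1 m3, sedge m2 m1 -> sedge m2 m3 -> m1 = m3} ->
  (#|A| <= q ^ 2 + q + 1)%N.
Proof.
move=> AP; have q1 : (1 < q)%N := finNzRing_gt1 F.
case: (boolP [exists m1 in A, exists m2 in A, sedge m1 m2]) => [|no]; last first.
  apply: intersecting_card => t l tA lA; apply: contra no => e.
  by apply/exists_inP; exists t => //; apply/exists_inP; exists l.
case/exists_inP => m1 m1A /exists_inP [m2 m2A e12].
pose B := A :\ m1 :\ m2.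
have cA : (#|A| <= #|B| + 2)%N.
  rewrite (cardsD1 m1 A) (cardsD1 m2 (A :\ m1)) -/B addnA addnC leq_add2l.
  by rewrite (leq_add (leq_b1 _) (leq_b1 _)).
have inB t : t \in B -> [/\ t \in A, t != m1 & t != m2].
  by case/setD1P => ? /setD1P [].
have BT : {in B, forall t, is_transversal_to m1 m2 t}.
  move=> t /inB [tA t1 t2]; apply/andP; split; rewrite capvC.
    by apply: contra t2 => e; rewrite (AP m1 t m2).
  by apply: contra t1 => e; rewrite (AP m2 t m1) // sedge_sym.
case: (boolP [exists l1 in B, exists l2 in B, sedge l1 l2]) => [|no].
  case/exists_inP => l1 l1B /exists_inP [l2 l2B el].
  have [[l1A _ _] [l2A _ _]] := (inB _ l1B, inB _ l2B).
  have cB : (#|B| <= #|B :\ l1 :\ l2| + 2)%N.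
    rewrite (cardsD1 l1 B) (cardsD1 l2 (B :\ l1)) addnA addnC leq_add2l.
    by rewrite (leq_add (leq_b1 _) (leq_b1 _)).
  have c2 : (#|B :\ l1 :\ l2| <= 2)%N.
    apply: (grid_matching_card e12 el (BT _ l1B) (BT _ l2B)) => t.
    case/setD1P => tl2 /setD1P [tl1 tB]; have [tA _ _] := inB _ tB.
    split; first exact: BT.
      by apply: contra tl2 => e; rewrite (AP l1 t l2) // sedge_sym.
    by apply: contra tl1 => e; rewrite (AP l2 t l1) // sedge_sym.
  move: cA cB c2 q1; move: #|A| #|B| #|_ :\ l2| q; clear; nia.
have cB : (#|B| <= 2 * q + 1)%N.
  apply: (grid_intersecting_card e12 BT) => t l tB lB; apply: contra no => e.
  by apply/exists_inP; exists t => //; apply/exists_inP; exists l.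
move: cA cB q1; move: #|A| #|B| q; clear; nia.
Qed.

Lemma dominant_exists A : (q ^ 2 + q + 1 < #|A|)%N ->
  exists C : {set G}, [/\ C \subset A, C != set0, induces_connected C & dominant C].
Proof.
move=> cA; have q1 : (1 < q)%N := finNzRing_gt1 F.
case: (boolP [exists m2 in A, exists m1 in A, exists m3 in A,
   [&& sedge m2 m1, sedge m2 m3 & m1 != m3]]) => [|no]; last first.
  have := cA; rewrite ltnNge matching_card // => m2 m1 m3 m2A m1A m3A e21 e23.
  apply/eqP; apply: contraNT no => n.
  apply/exists_inP; exists m2 => //; apply/exists_inP; exists m1 => //.
  by apply/exists_inP; exists m3; rewrite ?e21 ?e23.
case/exists_inP => m2 m2A /exists_inP [m1 m1A] /exists_inP [m3 m3A /and3P [e21 e23 m13]].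
have MA : [set m1; m2; m3] \subset A.
  by rewrite !subUset !sub1set m1A m2A.
have [c1 c2] : (3 * q + 1 < #|A| /\ q + 1 <= 2 * q)%N.
  by move: cA q1; move: #|A| q; clear; nia.
case: (boolP (sedge m1 m3)) => e13.
  have c := regulus_card e21 e23 e13.
  apply: (dominant_near_path MA e21 e23 c1).
    by apply: leq_trans (leq_trans c c2); apply: subset_leq_card; apply: subsetDl.
  by move=> B BM; rewrite ltnNge (leq_trans (subset_leq_card BM) c).
apply: (dominant_near_path MA e21 e23 c1); first exact: cross_card.
by move=> B; apply: cross_closed.
Qed.

Lemma pencil_independent p : \dim p = 1%N ->
  {in pencil fullv p &, forall t l : G, ~~ sedge t l}.
Proof.
move=> dp t l; rewrite !in_set => /andP [pt _] /andP [pl _].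
by apply: meetS pt pl; rewrite -dimv_gt0 dp.
Qed.

Lemma closed_neighbourhood_card p (v : G) : \dim p = 1%N -> v \in pencil fullv p ->
  (#|v |: [set u | sedge v u]| <= #|G| - (q ^ 2 + q + 1))%N.
Proof.
move=> dp vp; have q1 : (1 < q)%N := finNzRing_gt1 F.
have pv : p <= val v by move: vp; rewrite in_set => /andP [].
have [p' /andP [p'v p'p]] : exists p', (p' \in points (val v)) && (p' != p).
  have : (0 < #|points (val v) :\ p|)%N.
    have := card_points2 (dim_line v); rewrite (cardsD1 p) => h.
    rewrite -(ltn_add2l (p \in points (val v))) h addn0 ltnS.
    by apply: leq_trans (leq_b1 _) (ltnW q1).
  by case/card_gt0P => p'; rewrite in_setD1 andbC; exists p'.
move: p'v; rewrite in_set => /andP [/eqP dp' p'v].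
have [u up' uv] : exists2 u : G, u \in pencil fullv p' & u != v.
  have : (0 < #|pencil fullv p' :\ v|)%N.
    have := card_pencil_fullv dp'; rewrite (cardsD1 v) => h.
    rewrite -(ltn_add2l (v \in pencil fullv p')) h addn0.
    apply: leq_ltn_trans (leq_b1 _) _.
    by move: q1; rewrite /q; move: #|F|; clear; nia.
  by case/card_gt0P => u; rewrite in_setD1 => /andP [uv up]; exists u.
have p'u : p' <= val u by move: up'; rewrite in_set => /andP [].
have up : u \notin pencil fullv p.
  apply: contra uv; rewrite in_set => /andP [pu _]; apply/eqP; apply: val_inj.
  rewrite eq_sym in p'p.
  by rewrite -(span_points (dim_line u) dp dp' pu p'u p'p)
     -(span_points (dim_line v) dp dp' pv p'v p'p).
have sub : u |: (pencil fullv p :\ v) \subset ~: (v |: [set u | sedge v u]).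
  apply/subsetP => t; rewrite in_setU1 in_setC in_setU1 in_set negb_or.
  case/orP => [/eqP ->|/setD1P [tv tp]].
    rewrite uv /=; apply: meetS p'v p'u.
    by rewrite -dimv_gt0 dp'.
  by rewrite tv (pencil_independent dp).
have := subset_leq_card sub.
rewrite cardsU1 in_setD1 (negPf up) andbF -[#|~: _|]addn0 /=.
have := cardsD1 v (pencil fullv p); rewrite vp => <-; rewrite card_pencil_fullv //.
have := cardsC (v |: [set u | sedge v u]).
rewrite addn0 => <- h.
by rewrite -addnBA // leq_addr.
Qed.

Theorem qkneser421_max_bag :
  (exists D : tree_decomposition G,
     (\max_(x : td_tree D) #|td_bag x| <= #|G| - (q ^ 2 + q + 1))%N) /\
  (forall D : tree_decomposition G,
     (#|G| - (q ^ 2 + q + 1) <= \max_(x : td_tree D) #|td_bag x|)%N).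
Proof.
split; last by apply: max_bag_lower_bound; apply: dominant_exists.
pose p : {vspace 'rV[F]_4} := <[vpick {: 'rV[F]_4}]>.
have dp : \dim p = 1%N by rewrite dim_vline vpick0 -dimv_eq0 dim_rV4.
apply: (@star_decomposition G (pencil fullv p)).
- exact: pencil_independent.
- by rewrite cardsCs setCK (card_pencil_fullv dp).
by move=> v; apply: closed_neighbourhood_card.
Qed.

End Treewidth.

Theorem theorem1p6 (q : nat) (hq : prime_power q)
    (F : finFieldType) (hF : #|F| = q) :
  is_treewidth (qkneser421 F)
    (#|qkneser421 F|%:Z - (q ^ 2 + q + 2)%N%:Z)%R.
Proof.
subst q; have [[D hD] lb] := qkneser421_max_bag F.
have kG : (#|F| ^ 2 + #|F| + 1 <= #|qkneser421 F|)%N.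
  pose p : {vspace 'rV[F]_4} := <[vpick {: 'rV[F]_4}]>%VS.
  have dp : \dim p = 1%N by rewrite dim_vline vpick0 -dimv_eq0 dim_rV4.
  by rewrite -(card_pencil_fullv dp); apply: max_card.
have arith (N k : nat) : (k + 1 <= N)%N ->
    ((N - (k + 1))%N%:Z - 1 = N%:Z - (k + 2)%N%:Z)%R by lia.
have mono (a b : nat) : (a <= b)%N -> (a%:Z - 1 <= b%:Z - 1)%R by lia.
rewrite -(arith _ _ kG); split=> [|D']; last by apply: mono.
exists D; rewrite /td_width; congr (_%:Z - 1)%R.
by apply/eqP; rewrite eqn_leq hD lb.
Qed.
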